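(* Let $\theta \in \mathbb{R}\setminus\mathbb{Q}$ and let $a_n = n\theta \bmod 1$ for $n = 0,1,2,\dots$ (the Kronecker sequence). Let $N \ge 1$ and let $\pi$ be the permutation of $\{0,1,\dots,N-1\}$ with $a_{\pi(0)} < a_{\pi(1)} < \dots < a_{\pi(N-1)}$. If $N = \pi(1) + \pi(N-1)$, then the $N$-th sequence graph of $(a_n)$ can be embedded into the torus (i.e. drawn on the torus with no edge crossings).
   Context: For a sequence $a_0,a_1,\dots$ of pairwise distinct real numbers and $N\ge 1$, let $\pi$ be the permutation of $\{0,\dots,N-1\}$ such that $a_{\pi(0)}<\dots<a_{\pi(N-1)}$. The $N$-th sequence graph of the sequence is the 4-regular graph on vertex set $\{0,1,\dots,N-1\}$ whose edges are those of two Hamiltonian cycles: the cycle $C_1$ with edges $(0,1),(1,2),\dots,(N-2,N-1),(N-1,0)$, and the cycle $C_\pi$ with edges $(\pi(0),\pi(1)),(\pi(1),\pi(2)),\dots,(\pi(N-2),\pi(N-1)),(\pi(N-1),\pi(0))$. *)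

(* Defs.v *)
From mathcomp Require Import all_boot all_order all_algebra all_fingroup.
From mathcomp Require Import all_classical all_reals all_analysis.

Set Implicit Arguments.
Unset Strict Implicit.
Unset Printing Implicit Defensive.

Import Order.TTheory GRing.Theory Num.Theory.
Import numFieldNormedType.Exports.

Local Open Scope classical_set_scope.
Local Open Scope ring_scope.

(* Undirected multigraphs: loops and parallel edges are allowed. The order of
   the two ends of an edge only fixes the direction in which an arc drawing
   that edge is parametrized. *)
Record multigraph := Multigraph {
  vertex : finType;
  edge : finType;
  ends : edge -> vertex * vertex }.

Definition kronecker (R : realType) (theta : R) (n : nat) : R :=
  n%:R * theta - (Num.floor (n%:R * theta))%:~R.

Definition sorts (R : realType) (a : nat -> R) (N : nat) (p : {perm 'I_N}) :=
  forall i j : 'I_N, (i < j)%N -> a (p i) < a (p j).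

(* When [sorts a p], this is the N-th sequence graph of [a]. The edges [inl i]
   form the cycle C_1 and the edges [inr i] the cycle C_p ([ordS] is the cyclic
   successor). Edges are counted with multiplicity, so that the graph is
   4-regular also when the two cycles share edges or when N <= 2. *)
Definition sequence_graph (N : nat) (p : {perm 'I_N}) : multigraph :=
  @Multigraph 'I_N ('I_N + 'I_N)%type
    (fun e => match e with
              | inl i => (i, ordS i)
              | inr i => (p i, p (ordS i))
              end).

Definition circle (R : realType) : set (R * R) :=
  [set z | z.1 ^+ 2 + z.2 ^+ 2 = 1].

Definition torus (R : realType) : set ((R * R) * (R * R)) :=
  @circle R `*` @circle R.

(* [f] places the vertices and [g e] is the arc drawing the edge [e]. Only the
   open arcs are required to be injective, so that a loop is drawn as a simple
   closed curve; together with [injective f] and the fact that open arcs avoid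
   the vertices, the arc of any other edge is injective on [0, 1]. *)
Definition crossing_free_drawing (R : realType) (T : topologicalType)
    (S : set T) (G : multigraph) (f : vertex G -> T) (g : edge G -> R -> T) :=
  [/\ injective f /\ (forall v, S (f v)),
      forall e, [/\ {within `[0, 1], continuous (g e)},
                    g e @` `[0, 1] `<=` S,
                    g e 0 = f (ends e).1 &
                    g e 1 = f (ends e).2],
      forall e, {in `]0, 1[ &, injective (g e)},
      forall e v (t : R), t \in `]0, 1[ -> g e t <> f v &
      forall e e' (s t : R), e <> e' -> s \in `]0, 1[ -> t \in `]0, 1[ ->
        g e s <> g e' t].

Definition toroidal (R : realType) (G : multigraph) :=
  exists (f : vertex G -> (R * R) * (R * R))
         (g : edge G -> R -> (R * R) * (R * R)),
    crossing_free_drawing (@torus R) f g.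

(* Main.v *)
(** Write [a] and [b] for the indices of the smallest nonzero and of the
    largest term among the first [N = a + b] terms. Since [v + a mod N] is
    [v + a] or [v - b], and since [a] and [b] are extremal, passing from [v] to
    [v + a mod N] increases the term unless [v = b]. An injective self-map of a
    finite chain which moves every element but the last one upwards is the
    successor, so C_p consists of the edges from [v] to [v + a mod N] and the
    graph is a circulant graph. On the torus (R/Z)^2 put [v] at [(v / N, 0)];
    the edges of C_1 follow the circle [y = 0], and the edge of C_p leaving
    [v] is the segment [t |-> ((v + a t) / N, t)]. These segments are parallel
    and disjoint. *)

Require Import Defs.
From mathcomp Require Import all_boot all_order all_algebra all_fingroup.
From mathcomp Require Import all_classical all_reals all_analysis.
From mathcomp Require Import zify ring lra.

Set Implicit Arguments.
Unset Strict Implicit.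
Unset Printing Implicit Defensive.

Import Order.TTheory GRing.Theory Num.Theory.
Import numFieldNormedType.Exports.

Local Open Scope classical_set_scope.
Local Open Scope ring_scope.

(** * Self-maps of a finite chain *)

(** Downward induction from the top of the chain: if [q i] exceeded [i + 1], its predecessor would
    lie above [i] and, by induction, already be sent to [q i], against injectivity. *)
Lemma injective_gt_succ (N : nat) (q : 'I_N -> 'I_N) : injective q ->
  (forall i : 'I_N, (i < N.-1)%N -> (i < q i)%N) ->
  forall i : 'I_N, (i < N.-1)%N -> q i = i.+1 :> nat.
Proof.
move=> q_inj q_gt i; have [m] := ubnP (N - i).
elim: m i => // m IHm i ltNi lti.
have [//|gt_qi] := eqVneq (q i : nat) i.+1.
have lt_iq := q_gt i lti; have ltqN := ltn_ord (q i).
have ltjN : ((q i).-1 < N)%N by lia.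
have qj : q (Ordinal ltjN) = (q i).-1.+1 :> nat by apply: IHm => /=; lia.
have /q_inj/(congr1 val)/= : q (Ordinal ltjN) = q i.
  by apply: val_inj; rewrite /= qj; lia.
by lia.
Qed.

(** * Order of the terms of the Kronecker sequence *)

Section Kronecker.
Context {R : realType} (theta : R).
Local Notation K := (kronecker theta).

Lemma kronecker0 : K 0 = 0.
Proof. by rewrite /kronecker mul0r floor0 subrr. Qed.

Lemma kronecker_ge0_lt1 (n : nat) : 0 <= K n < 1.
Proof.
rewrite /kronecker; have := floor_itv (n%:R * theta); rewrite intrD.
by move=> /andP[? ?]; lra.
Qed.

(** The integer by which the floor of a sum exceeds the sum of the floors lies strictly between -1
    and 2, because all three fractional parts lie in [0, 1). *)
Lemma kroneckerD (m n : nat) :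
  K (m + n) = K m + K n \/ K (m + n) = K m + K n - 1.
Proof.
have := kronecker_ge0_lt1 m; have := kronecker_ge0_lt1 n.
have := kronecker_ge0_lt1 (m + n); rewrite /kronecker natrD mulrDl.
set x := m%:R * _; set y := n%:R * _.
have [z ->] : exists z, Num.floor (x + y) = Num.floor x + Num.floor y + z.
  by exists (Num.floor (x + y) - Num.floor x - Num.floor y); ring.
rewrite !intrD.
move: x y (Num.floor x)%:~R (Num.floor y)%:~R => x y u w.
move=> /andP[h1 h2] /andP[h3 h4] /andP[h5 h6].
have zgt : (-1 : R) < z%:~R by lra.
have zlt : z%:~R < (2 : R) by lra.
move: zgt zlt; rewrite -[-1]/((-1)%:~R) -[2]/(2%:~R) !ltr_int => zgt zlt.
have [->|->] : z = 0 \/ z = 1 by lia.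
- by left; rewrite mulr0z; ring.
- by right; ring.
Qed.

(** A wrap past 1 would give [K m + K a - 1], which is less than [K a]; so there is none, and the
    term grows by [K a]. *)
Lemma kronecker_lt_addr (m a : nat) : 0 < K a -> K a <= K (m + a) ->
  K m < K (m + a).
Proof.
have := kronecker_ge0_lt1 m.
by have [->|->] := kroneckerD m a => /andP[? ?] ? ?; lra.
Qed.

(** Without a wrap past 1 the sum would exceed [K b]; so it wraps, and the term drops by
    [1 - K b]. *)
Lemma kronecker_gt_addr (m b : nat) : 0 < K m -> K (m + b) <= K b ->
  K (m + b) < K m.
Proof.
have := kronecker_ge0_lt1 b.
by have [->|->] := kroneckerD m b => /andP[? ?] ? ?; lra.
Qed.

Lemma sorts_le (N : nat) (p : {perm 'I_N}) (i j : 'I_N) :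
  sorts K p -> (i <= j)%N -> K (p i) <= K (p j).
Proof.
move=> hp; rewrite leq_eqVlt => /orP[/eqP/val_inj -> //|/hp/ltW //].
Qed.

Lemma sorts_kronecker0 (N : nat) (p : {perm 'I_N}) (i : 'I_N) :
  sorts K p -> i = 0%N :> nat -> p i = 0%N :> nat.
Proof.
move=> hp i0; have N_gt0 : (0 < N)%N by apply: leq_ltn_trans (ltn_ord i).
pose j := (p^-1)%g (Ordinal N_gt0).
have pj : p j = 0%N :> nat by rewrite permKV.
have [<- //|neq_ij] := eqVneq j i.
have : (i < j)%N.
  rewrite i0 lt0n; apply: contra_neq neq_ij => j0.
  by apply: val_inj; rewrite /= j0.
move=> /hp; rewrite pj kronecker0 ltNge.
by have /andP[-> _] := kronecker_ge0_lt1 (p i).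
Qed.

Lemma sorts_kronecker_rotation (N : nat) (p : {perm 'I_N}) (i1 ilast : 'I_N) :
  sorts K p -> i1 = 1%N :> nat -> ilast = N.-1 :> nat ->
  N = (p i1 + p ilast)%N ->
  forall i : 'I_N, p (ordS i) = ((p i + p i1) %% N)%N :> nat.
Proof.
move=> hp hi1 hilast hsum.
have N_gt1 : (1 < N)%N by rewrite -hi1.
have N_gt0 := ltnW N_gt1.
pose o := Ordinal N_gt0; have po : p o = 0%N :> nat by apply: sorts_kronecker0.
set a := p i1 in hsum *; set b := p ilast in hsum.
have Kmax v : K (v : 'I_N) <= K b.
  rewrite -[v](permKV p); apply: sorts_le => //.
  by rewrite hilast -ltnS prednK.
have Kmin (v : 'I_N) : (0 < v)%N -> K a <= K v.
  move=> v_gt0; rewrite -[v](permKV p); apply: sorts_le => //.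
  rewrite hi1 lt0n; apply: contraTneq v_gt0 => v0.
  by rewrite -[v](permKV p) (sorts_kronecker0 hp v0).
have Ka_gt0 : 0 < K a by rewrite -kronecker0 -po; apply: hp; rewrite hi1.
pose s (v : 'I_N) := Ordinal (ltn_pmod (v + a) N_gt0).
have s_inj : injective s.
  move=> u v /(congr1 val)/= /eqP; rewrite eqn_modDr !modn_small //.
  by move=> /eqP/val_inj.
have s_gt (v : 'I_N) : v != b -> K v < K (s v).
  move=> neq_vb; have ltvN := ltn_ord v; have ltbN := ltn_ord b.
  have ltaN := ltn_ord a.
  have [ltvb|ltbv|/val_inj eq_vb] := ltngtP v b;
    last by rewrite eq_vb eqxx in neq_vb.
  - have sv : s v = (v + a)%N :> nat by rewrite /= modn_small; lia.
    have /Kmin : (0 < s v)%N.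
      rewrite sv addn_gt0 orbC lt0n; apply/orP; left.
      by apply: contraTneq Ka_gt0 => ->; rewrite kronecker0 ltxx.
    by rewrite sv; exact: kronecker_lt_addr.
  (* Read backwards, this step adds [b] to [s v]; maximality of [K b] forces a wrap, so [v] has the
     smaller term. *)
  - have sv : s v = (v - b)%N :> nat.
      rewrite /= (_ : (v + a = v - b + N)%N); last by lia.
      by rewrite modnDr modn_small; lia.
    have /Kmin : (0 < s v)%N by rewrite sv; lia.
    move=> /(lt_le_trans Ka_gt0) Ksv_gt0.
    have svb : (s v + b = v)%N by rewrite sv subnK // ltnW.
    by have := kronecker_gt_addr Ksv_gt0 (b := b); rewrite svb; apply.
(* Conjugation by [p] carries the rotation from indices to ranks, where increasing the term means
   moving up the chain. *)
pose q i := (p^-1)%g (s (p i)).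
have q_inj : injective q by move=> i j /perm_inj/s_inj/perm_inj.
have pq i : p (q i) = s (p i) by rewrite permKV.
have q_succ := injective_gt_succ q_inj.
move=> i; suff -> : ordS i = q i by rewrite pq.
apply: val_inj => /=; have [lti|gei] := ltnP i N.-1.
- rewrite q_succ => //; first by rewrite modn_small; lia.
  move=> j ltj; rewrite ltnNge; apply/negP => /(sorts_le hp).
  rewrite pq leNgt s_gt //; apply: contraTneq ltj => /perm_inj ->.
  by rewrite hilast ltnn.
(* The last rank holds [b], and [b + a = N] reduces to index 0, which has rank 0: the cycle closes
   up. *)
- have -> : i = ilast.
    by apply: val_inj; rewrite /= hilast; have := ltn_ord i; lia.
  have -> : q ilast = o.
    apply: (@perm_inj _ p); rewrite pq; apply: val_inj => /=.
    by rewrite po -/b addnC -hsum modnn.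
  by rewrite /= hilast prednK // modnn.
Qed.

End Kronecker.

(** * Parametrization of the circle with period 1 *)

Section CirclePoint.
Context {R : realType}.
Implicit Types x y : R.

(** Identifies R/Z with the unit circle, so that points of the torus can be given by coordinates
    modulo 1. *)
Definition circle_point x : R * R := (cos (pi *+ 2 * x), sin (pi *+ 2 * x)).

Lemma circle_circle_point x : circle (circle_point x).
Proof. exact: cos2Dsin2. Qed.

Lemma circle_pointDn x (n : nat) : circle_point (x + n%:R) = circle_point x.
Proof.
rewrite /circle_point mulrDr mulr_natr.
by rewrite (periodicn (@cosD2pi R)) (periodicn (@sinD2pi R)).
Qed.

(** Equal points give [cos (2 * pi * (x - y)) = 1], hence [sin (pi * (x - y)) = 0] by the half-angle
    formula; but sine has no zero strictly between 0 and [pi]. *)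
Lemma circle_point_inj x y : `|x - y| < 1 ->
  circle_point x = circle_point y -> x = y.
Proof.
wlog le_yx : x y / y <= x.
  move=> wlog_yx; have [|/ltW] := leP y x; first exact: wlog_yx.
  by move=> le_xy; rewrite distrC => lt1 /esym eq_xy; apply/esym/wlog_yx.
rewrite ger0_norm ?subr_ge0 // => lt1 [eq_cos eq_sin].
have : cos ((pi * (x - y)) *+ 2) = 1.
  rewrite -mulrnAl mulrBr cosB eq_cos eq_sin -!expr2; exact: cos2Dsin2.
rewrite cos_mulr2n cos2sin2 => sin2.
have : sin (pi * (x - y)) ^+ 2 == 0 by apply/eqP; lra.
rewrite sqrf_eq0 => /eqP sin0.
apply/eqP; rewrite eq_le le_yx andbT leNgt; apply/negP => lt_yx.
have := pi_gt0 R => pi_gt0.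
suff /sin_gt0_pi : 0 < pi * (x - y) < pi by rewrite sin0 ltxx.
by rewrite mulr_gt0 ?subr_gt0 // gtr_pMr.
Qed.

Lemma continuous_circle_point : continuous circle_point.
Proof.
have cm x : {for x, continuous ( *%R (pi *+ 2 : R))} by exact: mulrl_continuous.
move=> x; apply: (@cvg_pair _ _ _ _ (nbhs _) (nbhs _)) => /=.
- by apply: (continuous_comp (cm x)); exact: continuous_cos.
- by apply: (continuous_comp (cm x)); exact: continuous_sin.
Qed.

End CirclePoint.

(** * Drawing circulant graphs on the torus *)

Lemma natrD_inj (R : realType) (i j : nat) (s t : R) :
  0 <= s < 1 -> 0 <= t < 1 -> i%:R + s = j%:R + t -> i = j /\ s = t.
Proof.
move=> /andP[s0 s1] /andP[t0 t1] eq_ij.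
have lt_ij : (i%:R : R) < j.+1%:R by rewrite -natr1; lra.
have lt_ji : (j%:R : R) < i.+1%:R by rewrite -natr1; lra.
rewrite !ltr_nat in lt_ij lt_ji.
have ij : i = j by lia.
by split=> //; move: eq_ij; rewrite ij => /addrI.
Qed.

Lemma circulant_toroidal (R : realType) (N : nat) (p : {perm 'I_N}) (a : nat) :
  (forall i : 'I_N, p (ordS i) = ((p i + a) %% N)%N :> nat) ->
  toroidal R (sequence_graph p).
Proof.
case: N p => [|n] p hp.
  (* For [N = 0] there are neither vertices nor edges, so any maps will do. *)
  by exists (fun _ => ((0, 0), (0, 0))), (fun _ _ => ((0, 0), (0, 0)));
     split; [split; case|case; case|case; case|case; case|case; case].
set N := n.+1 in p hp *.
have N_gt0 : 0 < (N%:R : R) by rewrite ltr0n.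
have N_neq0 : (N%:R : R) != 0 by rewrite gt_eqF.
pose c := @circle_point R.
pose h (x : R) := c (x / N%:R).
(* [h] has period [N], so it does not see reduction of indices modulo [N]. *)
have hmod m : h (m %% N)%N%:R = h m%:R.
  rewrite [in RHS](divn_eq m N) natrD natrM addrC /h mulrDl mulfK //.
  by rewrite /c circle_pointDn.
have h_inj x y : `|x - y| < N%:R -> h x = h y -> x = y.
  move=> lt_xy /circle_point_inj eq_xy; apply: (mulIf (invr_neq0 N_neq0)).
  apply: eq_xy; rewrite -mulrBl normrM normfV (gtr0_norm N_gt0).
  by rewrite ltr_pdivrMr ?mul1r.
have ub (k : 'I_N) : (k%:R : R) + 1 <= N%:R by rewrite natr1 ler_nat.
have lb (k : 'I_N) : 0 <= (k%:R : R) by exact: ler0n.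
(* The numbers [i + s] and [j + t] lie in [0, N), one period of [h]. *)
have h_ord_inj (i j : 'I_N) (s t : R) : 0 <= s < 1 -> 0 <= t < 1 ->
    h (i%:R + s) = h (j%:R + t) -> i = j /\ s = t.
  move=> s01 t01 /h_inj eq_st; have [] := @natrD_inj R i j s t s01 t01; last by move=> /val_inj.
  apply: eq_st; move: s01 t01 => /andP[? ?] /andP[? ?].
  have := ub i; have := ub j; have := lb i; have := lb j.
  by rewrite ltr_norml => *; apply/andP; split; lra.
have h_cont (u w : R) : continuous (fun t => h (u + w * t)).
  move=> t; apply: (@continuous_comp _ _ _ (fun t => (u + w * t) / N%:R) c).
    apply: cvgM; last exact: cvg_cst.
    by apply: cvgD; [exact: cvg_cst|exact: mulrl_continuous].
  exact: continuous_circle_point.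
have le01 (t : R) : t \in `]0, 1[ -> 0 <= t < 1.
  by rewrite in_itv /= => /andP[/ltW -> ->].
have ne0 (t : R) : t \in `]0, 1[ -> t <> 0.
  by rewrite in_itv /= => /andP[/lt0r_neq0/eqP].
have z01 : 0 <= (0 : R) < 1 by rewrite lexx ltr01.
have c_inj (s t : R) : 0 <= s < 1 -> 0 <= t < 1 -> c s = c t -> s = t.
  move=> /andP[? ?] /andP[? ?]; apply: circle_point_inj.
  by rewrite ltr_norml; apply/andP; split; lra.
have c1 : c 1 = c 0 by rewrite -[1]add0r -[X in c (_ + X)]/(1%:R) /c circle_pointDn.
pose f (v : 'I_N) := (h v%:R, c 0).
(* The factor 1 gives both families the affine form [u + w * t] required by [h_cont]. *)
pose g (e : 'I_N + 'I_N) t := match e with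
  | inl i => (h (i%:R + 1 * t), c 0)
  | inr i => (h ((p i)%:R + a%:R * t), c t) end.
have pair_eq (x y x' y' : R * R) : (x, y) = (x', y') -> x = x' /\ y = y'.
  by move=> [-> ->].
exists f, g; split=> /=.
- split=> [i j /pair_eq[eq_h _]|v]; last by split; exact: circle_circle_point.
  by have [] := h_ord_inj i j 0 0 z01 z01 _; rewrite ?addr0.
- case=> i /=; split.
  + apply: continuous_subspaceT => t.
    apply: (@cvg_pair _ _ _ _ (nbhs _) (nbhs _)) => /=; last exact: cvg_cst.
    exact: h_cont.
  + by move=> _ [t _ <-]; split; exact: circle_circle_point.
  + by rewrite mulr0 addr0.
  + by rewrite mulr1 natr1 /f /= hmod.
  + apply: continuous_subspaceT => t.
    apply: (@cvg_pair _ _ _ _ (nbhs _) (nbhs _)) => /=; first exact: h_cont.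
    exact: continuous_circle_point.
  + by move=> _ [t _ <-]; split; exact: circle_circle_point.
  + by rewrite mulr0 addr0.
  (* At [t = 1] the second coordinate is back at [c 0], and the first is that of [p i + a], which
     agrees modulo [N] with [p (ordS i)]. *)
  + by rewrite mulr1 -natrD c1 /f hp hmod.
(* The first coordinate separates the points of an arc of C_1, the second those of an arc of C_p. *)
- case=> i s t /le01 s01 /le01 t01 /pair_eq[]; rewrite ?mul1r.
    by move=> /(h_ord_inj _ _ _ _ s01 t01)[].
  by move=> _ /(c_inj _ _ s01 t01).
- case=> i v t ht /pair_eq[]; rewrite ?mul1r.
    rewrite -[v%:R]addr0 => /(h_ord_inj _ _ _ _ (le01 t ht) z01)[_ t0] _.
    exact: ne0 ht t0.
  by move=> _ /(c_inj _ _ (le01 t ht) z01); exact: ne0.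
- case=> i [] j s t neq_e hs ht /pair_eq[]; rewrite ?mul1r.
  + move=> /(h_ord_inj _ _ _ _ (le01 s hs) (le01 t ht))[eq_ij _] _.
    by rewrite eq_ij in neq_e.
  (* In the two mixed cases, an open arc of C_p never meets the circle with second coordinate [c 0]
     that carries C_1. *)
  + by move=> _ /esym/(c_inj _ _ (le01 t ht) z01); exact: ne0.
  + by move=> _ /(c_inj _ _ (le01 s hs) z01); exact: ne0.
  (* Equal second coordinates force equal parameters; the common shift [a * t] then cancels, and
     [p i], [p j] differ by less than the period [N]. *)
  + move=> + /(c_inj _ _ (le01 s hs) (le01 t ht)) eq_st; rewrite eq_st.
    move=> /h_inj eq_h; apply: neq_e; congr inr; apply: (@perm_inj _ p).
    have [] // := h_ord_inj (p i) (p j) 0 0 z01 z01.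
    rewrite !addr0; congr h; apply: (addIr (a%:R * t)); apply: eq_h.
    have := ub (p i); have := ub (p j); have := lb (p i); have := lb (p j).
    by rewrite ltr_norml => *; apply/andP; split; lra.
Qed.

Theorem theorem1p1 (R : realType) (theta : R) (htheta : irrational theta)
    (N : nat) (hN : (1 <= N)%N) (p : {perm 'I_N})
    (hp : sorts (kronecker theta) p)
    (i1 ilast : 'I_N) (hi1 : nat_of_ord i1 = 1%N)
    (hilast : nat_of_ord ilast = N.-1)
    (hsum : N = (p i1 + p ilast)%N) :
  toroidal R (sequence_graph p).
Proof.
exact: circulant_toroidal (sorts_kronecker_rotation hp hi1 hilast hsum).
Qed.
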